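(* Let $\Omega$ be any infinite set, let $\Sigma$ be a non-empty finite subset of $\Omega$, and let $f,g\in\Omega^\Omega$. Then the following are equivalent: (I) $\langle\operatorname{Sym}(\Omega)_{(\Sigma)},f,g\rangle=\Omega^\Omega$; (II) $\langle\operatorname{Sym}(\Omega)_{\{\Gamma\}},f,g\rangle=\Omega^\Omega$ for all $\Gamma\subseteq\Sigma$; (III) up to renaming $f$ and $g$: $f$ is injective, $d(f)=|\Omega|$, $g$ is surjective, and either $|\Omega|$ is regular and $k(g,|\Omega|)=|\Omega|$, or $|\Omega|$ is singular and $k(g,\nu)=|\Omega|$ for all cardinals $\nu<|\Omega|$; and for all non-empty $\Gamma\subseteq\Sigma$ one of the following holds: (i) $\Gamma f\not\subseteq\Gamma$ and $\Gamma g^{-1}\not\subseteq\Gamma$; (ii) $\Gamma g\not\subseteq\Gamma$, $\Gamma g^{-1}\not\subseteq\Gamma$, and $|\Gamma g|=|\Gamma|$; (iii) $\Gamma f\not\subseteq\Gamma$, $\Gamma f^{-1}\not\subseteq\Gamma$, and $\Gamma\subseteq\Omega f$.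
   Context: $\Omega^\Omega$ is the semigroup of all mappings from $\Omega$ to itself (written to the right of their arguments and composed from left to right), and $\operatorname{Sym}(\Omega)$ is the symmetric group on $\Omega$. $\langle\,\cdot\,\rangle$ denotes the subsemigroup generated. $\operatorname{Sym}(\Omega)_{(\Sigma)}$ is the pointwise stabiliser of $\Sigma$ in $\operatorname{Sym}(\Omega)$ and $\operatorname{Sym}(\Omega)_{\{\Gamma\}}$ is the setwise stabiliser of $\Gamma$. For $f\in\Omega^\Omega$ and $\Gamma\subseteq\Omega$, $\Gamma f=\{\alpha f:\alpha\in\Gamma\}$ and $\Gamma f^{-1}=\{\beta\in\Omega:\beta f\in\Gamma\}$; $d(f)=|\Omega\setminus\Omega f|$; for a cardinal $\mu\leq|\Omega|$, $k(f,\mu)=|\{\alpha\in\Omega:|\alpha f^{-1}|\geq\mu\}|$, where $\alpha f^{-1}=\{\beta\in\Omega:\beta f=\alpha\}$. The phrase ''up to renaming $f$ and $g$'' applies to the whole of (III), with the same naming used in the parameter conditions and in (i)-(iii). *)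

(* Defs.v *)
From mathcomp Require Import all_boot.
From mathcomp Require Import boolp classical_sets functions cardinality.

Set Implicit Arguments.
Unset Strict Implicit.
Unset Printing Implicit Defensive.

Local Open Scope classical_set_scope.
Local Open Scope card_scope.

(* Mappings act on the right in the source: there [fg] is "first f, then g",
   which is [g \o f] here, and [alpha f] is [f alpha]. *)
Definition subsemigroup (Omega : Type) (S : set (Omega -> Omega)) : Prop :=
  forall f g, S f -> S g -> S (g \o f).

Definition generated (Omega : Type) (A : set (Omega -> Omega)) :
    set (Omega -> Omega) :=
  smallest (@subsemigroup Omega) A.

Definition Sym (Omega : Type) : set (Omega -> Omega) :=
  [set h | bijective h].

Definition pointwise_stab (Omega : Type) (Sigma : set Omega) :
    set (Omega -> Omega) :=
  [set h | Sym h /\ forall x, Sigma x -> h x = x].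

Definition setwise_stab (Omega : Type) (Gamma : set Omega) :
    set (Omega -> Omega) :=
  [set h | Sym h /\ h @` Gamma = Gamma].

(* Cardinals are represented by sets of that cardinality and compared with
   [#<=] and [#=]. Every cardinal at most |Omega| is the cardinality of a
   subset of Omega, so quantifying over such cardinals is quantifying over
   [set Omega]. *)
Definition card_lt (T U : Type) (A : set T) (B : set U) : Prop :=
  A #<= B /\ ~ (B #<= A).

(* |T| is singular: T is a union of fewer than |T| sets, each of cardinality
   less than |T|. *)
Definition singular_card (T : Type) : Prop :=
  infinite_set [set: T] /\
  exists (I : set T) (F : T -> set T),
    [/\ card_lt I [set: T],
        forall i, I i -> card_lt (F i) [set: T] &
        \bigcup_(i in I) F i = [set: T]].

Definition regular_card (T : Type) : Prop :=
  infinite_set [set: T] /\ ~ singular_card T.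

(* d(f) is the cardinality of this set. *)
Definition defect_set (Omega : Type) (f : Omega -> Omega) : set Omega :=
  ~` range f.

(* k(f, |M|) is the cardinality of this set. *)
Definition kset (Omega : Type) (f : Omega -> Omega) (M : set Omega) :
    set Omega :=
  [set a | M #<= f @^-1` [set a]].

Definition parameter_conditions (Omega : Type) (f g : Omega -> Omega) : Prop :=
  [/\ injective f,
      defect_set f #= [set: Omega],
      set_surj [set: Omega] [set: Omega] g &
      (regular_card Omega /\ kset g [set: Omega] #= [set: Omega]) \/
      (singular_card Omega /\
       forall N : set Omega, card_lt N [set: Omega] ->
         kset g N #= [set: Omega])].

Definition moving_conditions (Omega : Type) (f g : Omega -> Omega)
    (Gamma : set Omega) : Prop :=
  [\/ ~ (f @` Gamma `<=` Gamma) /\ ~ (g @^-1` Gamma `<=` Gamma),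
      [/\ ~ (g @` Gamma `<=` Gamma), ~ (g @^-1` Gamma `<=` Gamma) &
          g @` Gamma #= Gamma] |
      [/\ ~ (f @` Gamma `<=` Gamma), ~ (f @^-1` Gamma `<=` Gamma) &
          Gamma `<=` range f]].

Definition condition_III (Omega : Type) (Sigma : set Omega)
    (f g : Omega -> Omega) : Prop :=
  parameter_conditions f g /\
  forall Gamma : set Omega, Gamma !=set0 -> Gamma `<=` Sigma ->
    moving_conditions f g Gamma.

(* Main.v *)
Require Import Defs.
From mathcomp Require Import all_boot finmap.
From mathcomp Require Import boolp classical_sets functions cardinality.

Set Implicit Arguments.
Unset Strict Implicit.
Unset Printing Implicit Defensive.

Local Open Scope classical_set_scope.
Local Open Scope card_scope.

(** Maps are written here as functions, so a word read from left to right is a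
    composite whose first letter acts first. Call a set large when it has
    cardinality |Omega|.

    The stabiliser of Sigma pointwise is contained in the stabiliser of each
    Gamma inside Sigma setwise, so the first condition implies the second.

    From the second condition to the third, every failure of a requirement
    exhibits a proper subsemigroup containing all the generators. With Gamma
    empty the whole symmetric group is available: the first non-permutation in
    a word for an injective map is injective, the last one in a word for a
    surjective map is surjective, and this names f and g. The maps of small
    defect form a semigroup; so do the maps with few large fibres, if |Omega|
    is regular; and so do the maps whose fibres, with few exceptions, are
    bounded by one cardinal below |Omega|. For a non-empty Gamma there are four semigroups:
    the maps sending Gamma into itself, those pulling Gamma back into itself,
    those that send Gamma into itself or shrink it, and those that pull Gamma
    back into itself or miss one of its points.

    From the third condition to the first, let U be the generated semigroup. It
    suffices to find in U an injective p of large defect whose range avoids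
    Sigma [exists_injective_avoiding], and a q with all fibres large
    [exists_all_large_fibres]: any h is then p, followed by a permutation fixing
    Sigma that moves each value p x into the fibre of q over h x, followed by q
    [factorization]. All permutations come from [match_stab], which extends a
    bijection between sets that are disjoint from Sigma and have large
    complements.

    Both p and q come from a minimality argument. Among the injective maps of U
    with large defect take one whose range meets Sigma in a set Gamma with as
    few points as possible. Minimality forces p to permute Gamma and forces
    every injective u in U to have Gamma in its range; a choice of u built
    from f, or from g when g is injective on Gamma, contradicts this unless
    Gamma is empty. Dually, among the surjective maps of U with only finitely
    many fibres that are not large, take q with as few such fibres as possible,
    and let Gamma be the set of points below them. Minimality forces Gamma to
    lie in Sigma. It also forces Gamma to contain its preimage under every
    surjective u in U whose fibres over points outside Gamma are not contained
    in Gamma; for u equal to g followed by q, or to f followed by a permutation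
    and q, this contradicts the hypothesis on Gamma.

    The cardinal arithmetic behind this is the comparability of cardinals
    [card_le_total] and the existence of an injective pairing on every infinite
    set [exists_pairing]. *)

(** * Injections and comparison of cardinals *)

Definition inj_on (T U : Type) (A : set T) (e : T -> U) : Prop :=
  forall x y, A x -> A y -> e x = e y -> x = y.

Lemma card_leI (T U : Type) (A : set T) (B : set U) (e : T -> U) :
  (forall x, A x -> B (e x)) -> inj_on A e -> A #<= B.
Proof.
move=> eAB einj; have : $|{injfun A >-> B}|.
  apply/injfunPex; exists e => // x y; rewrite !inE; exact: einj.
by case=> i; apply: inj_card_le i.
Qed.

Lemma card_leE (T U : Type) (u0 : U) (A : set T) (B : set U) :
  A #<= B -> exists e : T -> U, (forall x, A x -> B (e x)) /\ inj_on A e.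
Proof.
move=> /card_leP[i].
exists (fun x => if pselect (A x) is left Ax
                 then set_val (i (SigSub (mem_set Ax))) else u0); split.
  by move=> x Ax; case: pselect => // Ax'; exact: set_valP.
move=> x y Ax Ay; case: pselect => // {}Ax; case: pselect => // {}Ay e.
have /(@inj _ _ _ i) : i (SigSub (mem_set Ax)) = i (SigSub (mem_set Ay)).
  by move: e; rewrite set_valE => /val_inj.
by rewrite !inE => /(_ I I) [].
Qed.

Lemma card_le_image_surj (T U : Type) (A : set T) (B : set U) (h : T -> U) :
  (forall y, B y -> exists2 x, A x & h x = y) -> B #<= A.
Proof.
move=> hAB; have : B `<=` h @` A by move=> y /hAB[x Ax <-]; exists x.
by move=> /subset_card_le /card_le_trans; apply; exact: card_image_le.
Qed.

Lemma inj_on_retract (T U : Type) (t0 : T) (A : set T) (e : T -> U) :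
  inj_on A e -> exists r : U -> T, forall x, A x -> r (e x) = x.
Proof.
move=> einj; have /choice[r rP] y : exists b,
    (exists2 x, A x & e x = y) -> A b /\ e b = y.
  have [[x Ax <-]|n] := pselect (exists2 x, A x & e x = y).
    by exists x.
  by exists t0.
by exists r => x Ax; have [//|Ar er] := rP (e x); [exists x | apply: einj].
Qed.

Lemma section (T U : Type) (h : T -> U) :
  (forall y, exists x, h x = y) -> exists s, cancel s h.
Proof. by move=> /choice[s hs]; exists s. Qed.

(** Matching the points of A with those of B by pairs is the same as picking
    pairwise disjoint two-element sets in the sum; a maximal matching leaves no
    point free on one of the two sides. *)
Lemma card_le_total (T U : Type) (A : set T) (B : set U) :
  A #<= B \/ B #<= A.
Proof.
pose F (i : T * U) : set (T + U) := [set inl i.1; inr i.2].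
have [E [EAB triv maxE]] := ex_maximal_disjoint_subcollection F (A `*` B).
have E1 x y y' : E (x, y) -> E (x, y') -> y = y'.
  move=> Exy Exy'; suff [] : (x, y) = (x, y') by [].
  by apply: triv => //; exists (inl x); split; left.
have E2 x x' y : E (x, y) -> E (x', y) -> x = x'.
  move=> Exy Exy'; suff [] : (x, y) = (x', y) by [].
  by apply: triv => //; exists (inr y); split; right.
have [dA|] := pselect (forall x, A x -> exists y, E (x, y)).
  left; apply: card_le_trans (_ : E #<= B); last first.
    apply: (@card_leI _ _ _ _ snd) => [[x y] /EAB[]//|].
    by move=> [x y] [x' y'] Ex Ey /= yy; rewrite -yy in Ey *; rewrite (E2 _ _ _ Ex Ey).
  by apply: (@card_le_image_surj _ _ _ _ fst) => x /dA[y Exy]; exists (x, y).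
move=> /existsNP[x0] /not_implyP[Ax0] /forallNP nEx0.
right; apply: card_le_trans (_ : E #<= A); last first.
  apply: (@card_leI _ _ _ _ fst) => [[x y] /EAB[]//|].
  by move=> [x y] [x' y'] Ex Ey /= xx; rewrite -xx in Ey *; rewrite (E1 _ _ _ Ex Ey).
apply: (@card_le_image_surj _ _ _ _ snd) => y By; apply: contrapT => nEy.
have {}nEy x : ~ E (x, y) by move=> Exy; apply: nEy; exists (x, y).
apply: (maxE (E `|` [set (x0, y)])).
- split; first by left.
  by move=> /(_ (x0, y)) /(_ (or_intror erefl)) /nEx0.
- by move=> z [/EAB//|->].
- move=> [x1 y1] [x2 y2] [E12|[-> ->]] [E12'|[-> ->]] //=; first exact: triv.
  + move=> [_ [[->|->] [e|e]]]; case: e => // e; subst.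
      by case: (nEx0 _ E12).
    by case: (nEy _ E12).
  + move=> [_ [[->|->] [e|e]]]; case: e => // e; subst.
      by case: (nEx0 _ E12').
    by case: (nEy _ E12').
Qed.

Section Pairing.
Context {T : Type}.

Let pairing_on (D : set T) (F : T -> T -> T) :=
  [/\ infinite_set D, forall x y, D x -> D y -> D (F x y) &
      forall x y x' y', D x -> D y -> D x' -> D y' ->
        F x y = F x' y' -> x = x' /\ y = y'].

Let countable_pairing :
  infinite_set [set: T] -> exists D F, pairing_on D F.
Proof.
move=> infT; have [t0 _] := infinite_setN0 infT.
have /infiniteP/(card_leE t0)[e [_ einj]] := infT.
have /card_eqPle[/(card_leE 0)[c [_ cinj]] _] := card_nat2.
have [r er] : exists r : T -> nat, cancel e r.
  by have [r rE] := inj_on_retract 0 einj; exists r => n; exact: rE.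
exists (range e), (fun a b => e (c (r a, r b))); split.
- apply/infiniteP; exact: (card_leI (e := e)).
- by move=> a b _ _; exists (c (r a, r b)).
- move=> _ _ _ _ [a _ <-] [b _ <-] [a' _ <-] [b' _ <-].
  by rewrite !er => /einj => /(_ I I) /cinj => /(_ I I) [-> ->].
Qed.

(** An infinite D with a pairing and a disjoint copy psi D of it: the three new
    blocks of (D u psi D)^2 are sent into psi D, told apart by three tags. *)
Let extend_pairing (D : set T) (F : T -> T -> T) (psi : T -> T) :
  pairing_on D F -> (forall x, D x -> ~ D (psi x)) -> inj_on D psi ->
  exists F', pairing_on (D `|` psi @` D) F' /\
    (forall x y, D x -> D y -> F' x y = F x y).
Proof.
move=> [infD FD Finj] psiD psiinj.
have [c1 [c2 [c3 [Dc1 Dc2 Dc3 [c12 c13 c23]]]]] : exists c1 c2 c3,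
    [/\ D c1, D c2, D c3 & [/\ c1 <> c2, c1 <> c3 & c2 <> c3]].
  have [c1 Dc1] := infinite_setN0 infD.
  have [c2 [Dc2 c2N]] :=
    infinite_setN0 (infinite_setD infD (finite_set1 c1)).
  have [c3 [Dc3 c3N]] :=
    infinite_setN0 (infinite_setD infD (finite_set2 c1 c2)).
  exists c1, c2, c3; split=> //; split=> e; subst.
  - exact: c2N.
  - by apply: c3N; left.
  - by apply: c3N; right.
have [r [rD rpsi]] : exists r, (forall x, D x -> r x = x) /\
    (forall x, D x -> r (psi x) = x).
  have [r rE] := inj_on_retract c1 psiinj.
  exists (fun x => if pselect (D x) then x else r x).
  split=> x Dx; case: pselect => // nD; last exact: rE.
  by case: (psiD _ Dx).
have rDE x : (D `|` psi @` D) x -> D (r x).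
  by move=> [Dx|[d Dd <-]]; [rewrite rD|rewrite rpsi].
have rinj x y : (D `|` psi @` D) x -> (D `|` psi @` D) y ->
    (D x <-> D y) -> r x = r y -> x = y.
  move=> [Dx|[d Dd <-]] [Dy|[d' Dd' <-]] xy.
  - by rewrite !rD.
  - by case: (psiD _ Dd'); apply/xy.
  - by case: (psiD _ Dd); apply/xy.
  - by rewrite !rpsi // => ->.
pose tag x y := if pselect (D x) then c1 else if pselect (D y) then c2 else c3.
have Dtag x y : D (tag x y) by rewrite /tag; do 2?case: pselect.
have DF u v : (D `|` psi @` D) u -> (D `|` psi @` D) v ->
    D (F (tag u v) (F (r u) (r v))).
  by move=> Eu Ev; apply/FD; [exact: Dtag|apply/FD; exact: rDE].
have [F' [F'old F'new]] : exists F' : T -> T -> T,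
    (forall x y, D x /\ D y -> F' x y = F x y) /\
    (forall x y, ~ (D x /\ D y) ->
       F' x y = psi (F (tag x y) (F (r x) (r y)))).
  exists (fun x y => if pselect (D x /\ D y) then F x y
                     else psi (F (tag x y) (F (r x) (r y)))).
  by split=> x y Dxy; case: (pselect (D x /\ D y)).
exists F'; split; last by move=> x y Dx Dy; exact: F'old.
split.
- by apply: sub_infinite_set infD => x; left.
- move=> x y Ex Ey; have [[Dx Dy]|nD] := pselect (D x /\ D y).
    by left; rewrite F'old //; apply: FD.
  by right; rewrite F'new //; exists (F (tag x y) (F (r x) (r y))) => //; exact: DF.
move=> x y x' y' Ex Ey Ex' Ey'.
have [/[dup] DD [Dx Dy]|nD] := pselect (D x /\ D y);
have [/[dup] DD' [Dx' Dy']|nD'] := pselect (D x' /\ D y').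
- by rewrite !F'old //; exact: Finj.
- rewrite F'old // F'new // => e.
  by case: (psiD _ (DF _ _ Ex' Ey')); rewrite -e; apply: FD.
- rewrite F'new // F'old // => e.
  by case: (psiD _ (DF _ _ Ex Ey)); rewrite e; apply: FD.
rewrite !F'new //.
move=> /psiinj => /(_ (DF _ _ Ex Ey) (DF _ _ Ex' Ey')) /Finj.
case; do ?[exact: Dtag|by apply/FD; exact: rDE].
move=> tE /Finj; case; do ?exact: rDE.
have [xx yy] : (D x <-> D x') /\ (D y <-> D y').
  move: tE; rewrite /tag; case: (pselect (D x)); case: (pselect (D x'));
    case: (pselect (D y)); case: (pselect (D y')) => //= *; try tauto;
    by subst; exfalso; auto.
by move=> /(rinj _ _ Ex Ex' xx) -> /(rinj _ _ Ey Ey' yy) ->.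
Qed.

(** Hessenberg's theorem. By Zorn's lemma there is a largest infinite D that
    carries a pairing. Its complement has no copy of D, by maximality, so it
    embeds in D, and then so does the whole type. *)
Lemma exists_pairing : infinite_set [set: T] ->
  exists F : T -> T -> T,
    forall x y x' y', F x y = F x' y' -> x = x' /\ y = y'.
Proof.
move=> infT; have [D0 [F0 DF0]] := countable_pairing infT.
have [t0 _] := infinite_setN0 infT.
pose S := {p : set T * (T -> T -> T) | pairing_on p.1 p.2}.
pose R (s t : S) := `[< (sval s).1 `<=` (sval t).1 /\
  forall x y, (sval s).1 x -> (sval s).1 y ->
     (sval t).2 x y = (sval s).2 x y >].
have [| | |[[D F] DF] maxD] := @ZL_preorder S (exist _ (D0, F0) DF0) R.
- by move=> s; apply/asboolP; split.
- move=> r s t /asboolP[rs1 rs2] /asboolP[st1 st2]; apply/asboolP; split.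
    exact: subset_trans st1.
  by move=> x y rx ry; rewrite st2 ?rs2 //; exact: rs1.
- move=> A totA; have [[s0 As0]|A0] := pselect (A !=set0); last first.
    by exists (exist _ (D0, F0) DF0) => s As; case: A0; exists s.
  pose D := \bigcup_(s in A) (sval s).1.
  pose F x y := if pselect (exists s, A s /\ ((sval s).1 x /\ (sval s).1 y))
    is left H then (sval (projT1 (cid H))).2 x y else t0.
  have FE s x y : A s -> (sval s).1 x -> (sval s).1 y ->
      F x y = (sval s).2 x y.
    move=> As sx sy; rewrite /F; case: pselect => [H|[]]; last by exists s.
    case: (cid H) => t /= [At [tx ty]].
    by case: (totA _ _ As At) => /asboolP[_ ->].
  have up s t : A s -> A t -> exists u, [/\ A u, (sval s).1 `<=` (sval u).1 &
      (sval t).1 `<=` (sval u).1].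
    by move=> As At; case: (totA _ _ As At) => /asboolP[st _];
      [exists t|exists s]; split=> //; exact: st.
  have DFok : pairing_on D F.
    split.
    - have [infs _ _] := svalP s0.
      by apply: sub_infinite_set infs => x s0x; exists s0.
    - move=> x y [s As sx] [t At ty]; have [u [Au su tu]] := up _ _ As At.
      exists u => //; rewrite (FE u) //; [|exact: su|exact: tu].
      by have [_ uD _] := svalP u; apply: uD; [exact: su|exact: tu].
    - move=> x y x' y' [s As sx] [t At ty] [s' As' sx'] [t' At' ty'].
      have [u [Au su tu]] := up _ _ As At.
      have [u' [Au' su' tu']] := up _ _ As' At'.
      have [v [Av uv uv']] := up _ _ Au Au'.
      have [_ _ vinj] := svalP v.
      rewrite !(FE v) //; do ?[exact/uv/su|exact/uv/tu|exact/uv'/su'|exact/uv'/tu'].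
      by apply: vinj;
        [exact/uv/su|exact/uv/tu|exact/uv'/su'|exact/uv'/tu'].
  exists (exist _ (D, F) DFok) => s As; apply/asboolP; split=> /=.
    by move=> x sx; exists s.
  by move=> x y sx sy; rewrite (FE s).
have [infD FD Finj] := DF; rewrite /= in infD FD Finj.
have [/(card_leE t0)[psi [psiD psiinj]]|] := card_le_total D (~` D).
  have [F' [DF' F'E]] := extend_pairing DF psiD psiinj.
  have [d Dd] := infinite_setN0 infD.
  have /asboolP[/= sub _] : R (exist _ (D `|` psi @` D, F') DF')
      (exist _ (D, F) DF).
    by apply: maxD; apply/asboolP; split => //= x Dx; left.
  by case: (psiD _ Dd); apply: sub; right; exists d.
move=> /(card_leE t0)[psi [psiD psiinj]].
have [c1 Dc1] := infinite_setN0 infD.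
have [c2 [Dc2 c2N]] := infinite_setN0 (infinite_setD infD (finite_set1 c1)).
pose j x := if pselect (D x) then F c1 x else F c2 (psi x).
have jD x : D (j x).
  by rewrite /j; case: (pselect (D x)) => Dx; apply/FD => //; exact: psiD.
have c12 : c1 <> c2 by move=> e; apply: c2N.
have jinj x y : j x = j y -> x = y.
  rewrite /j; case: (pselect (D x)) => Dx; case: (pselect (D y)) => Dy.
  - by case/(Finj _ _ _ _ Dc1 Dx Dc1 Dy).
  - by case/(Finj _ _ _ _ Dc1 Dx Dc2 (psiD _ Dy)).
  - by case/(Finj _ _ _ _ Dc2 (psiD _ Dx) Dc1 Dy) => /esym.
  - by case/(Finj _ _ _ _ Dc2 (psiD _ Dx) Dc2 (psiD _ Dy)) => _ /psiinj->.
exists (fun x y => F (j x) (j y)) => x y x' y' /Finj.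
by case => // /jinj-> /jinj->.
Qed.

End Pairing.

(** * Sets of full size *)

(** Stated for sets in any type, so that families of maps and sets of index
    pairs can also be said to have full size. *)
Definition large (Omega T : Type) (A : set T) : Prop := [set: Omega] #<= A.

Definition fibre (Omega : Type) (h : Omega -> Omega) (x : Omega) : set Omega :=
  h @^-1` [set x].

Section Large.
Context {Omega : Type}.
Local Notation large := (large Omega).

Lemma largeP (T : Type) (A : set T) :
  large A <-> exists e : Omega -> T, injective e /\ forall x, A (e x).
Proof.
split=> [/card_leP[i]|[e [einj eA]]].
  exists (fun x => set_val (i (SigSub (mem_setT x)))); split; last first.
    by move=> x; exact: set_valP.
  move=> x y; rewrite set_valE => /val_inj /(@inj _ _ _ i).
  by rewrite !inE => /(_ I I) [].
by apply: (card_leI (e := e)) => // x y _ _ /einj.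
Qed.

Lemma large_inj (T U : Type) (A : set T) (B : set U) (e : T -> U) :
  large A -> (forall x, A x -> B (e x)) -> inj_on A e -> large B.
Proof. by move=> lA eAB einj; exact: card_le_trans (card_leI eAB einj). Qed.

Lemma largeS (T : Type) (A B : set T) : A `<=` B -> large A -> large B.
Proof. by move=> AB lA; exact: card_le_trans (subset_card_le AB). Qed.

Lemma large_setT : large [set: Omega].
Proof. exact: card_lexx. Qed.

Lemma large_card (A : set Omega) : A #= [set: Omega] <-> large A.
Proof.
split=> [/card_eqPle[]//|lA]; apply/card_eqPle; split=> //; exact: card_leT.
Qed.

Lemma card_ltE (A : set Omega) : card_lt A [set: Omega] <-> ~ large A.
Proof. by split=> [[]//|]; split=> //; exact: card_leT. Qed.

Lemma large_image (T U : Type) (h : T -> U) (A : set T) :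
  large (h @` A) -> large A.
Proof. by move=> /card_le_trans; apply; exact: card_image_le. Qed.

Context (Omega_inf : infinite_set [set: Omega]).

Lemma large_infinite (T : Type) (A : set T) : large A -> infinite_set A.
Proof. by move=> lA finA; apply: Omega_inf; exact: card_le_finite lA finA. Qed.

(** Viewing the full-size set as a square, either a whole row lies in A, or
    every row has a point in B. *)
Lemma large_setU (T : Type) (A B : set T) :
  large (A `|` B) -> large A \/ large B.
Proof.
move=> /largeP[e [einj eAB]]; have [F Finj] := exists_pairing Omega_inf.
have [[x rowA]|noRow] := pselect (exists x, forall y, A (e (F x y))).
  left; apply/largeP; exists (fun y => e (F x y)); split=> //.
  by move=> y y' /einj /Finj[].
right; have /choice[c cB] x : exists y, B (e (F x y)).
  apply: contrapT => nB; apply: noRow; exists x => y.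
  by have [//|By] := eAB (F x y); case: nB; exists y.
apply/largeP; exists (fun x => e (F x (c x))); split=> //.
by move=> x x' /einj /Finj[].
Qed.

Lemma large_setD (T : Type) (A B : set T) :
  large A -> ~ large B -> large (A `\` B).
Proof.
move=> lA nB; have [|//|/nB//] := @large_setU _ (A `\` B) B.
by apply: largeS lA => x Ax; have [?|?] := pselect (B x); [right|left].
Qed.

Lemma large_setDfin (T : Type) (A B : set T) :
  large A -> finite_set B -> large (A `\` B).
Proof. by move=> lA finB; apply: large_setD => // /large_infinite. Qed.

Lemma large_setCfin (A : set Omega) : finite_set A -> large (~` A).
Proof.
by move=> finA; rewrite -setTD; exact: large_setDfin large_setT finA.
Qed.

(** Two rows of a square are disjoint copies of it: one is enumerated, the other
    is left over. *)
Lemma large_split (T : Type) (A : set T) : large A ->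
  exists e : Omega -> T,
    [/\ injective e, forall x, A (e x) & large (A `\` range e)].
Proof.
move=> /largeP[e [einj eA]]; have [F Finj] := exists_pairing Omega_inf.
have [c1 [c2 c12]] : exists c1 c2 : Omega, c1 <> c2.
  have [c1 _] := infinite_setN0 Omega_inf.
  have [c2 [_ c2N]] := infinite_setN0 (infinite_setD Omega_inf (finite_set1 c1)).
  by exists c1, c2 => e12; apply: c2N.
exists (fun x => e (F c1 x)); split=> [x y /einj /Finj[]|x|] //.
apply/largeP; exists (fun x => e (F c2 x)); split=> [x y /einj /Finj[]|x] //.
by split=> // -[y _ /einj /Finj[]].
Qed.

(** The larger factor, if infinite, contains a copy of its own square. *)
Lemma large_setX (T U : Type) (A : set T) (B : set U) :
  large (A `*` B) -> large A \/ large B.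
Proof.
have sq V (C : set V) : infinite_set C -> exists F : V -> V -> V,
    (forall x y, C x -> C y -> C (F x y)) /\
    (forall x y x' y', C x -> C y -> C x' -> C y' -> F x y = F x' y' ->
        x = x' /\ y = y').
  move=> infC; have infC' : infinite_set [set: C].
    by rewrite (eq_finite_set (card_setT C)).
  have [F Finj] := exists_pairing infC'.
  have [c0 Cc0] := infinite_setN0 infC.
  have [i iE] : exists i : V -> C, forall x, C x -> val (i x) = x.
    exists (fun x => if pselect (C x) is left Cx then SigSub (mem_set Cx)
                     else SigSub (mem_set Cc0)) => x Cx.
    by case: pselect.
  exists (fun x y => val (F (i x) (i y))); split.
    by move=> x y _ _; exact: set_valP.
  move=> x y x' y' Cx Cy Cx' Cy' /val_inj /Finj [ex ey].
  by rewrite -(iE x) // -(iE y) // ex ey !iE.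
suff H V W (C : set V) (D : set W) : C #<= D -> large (C `*` D) -> large D.
  have [AB|BA] := card_le_total A B; first by move=> /(H _ _ _ _ AB); right.
  move=> lAB; left; apply: (H _ _ _ _ BA).
  by apply: (large_inj (e := fun p => (p.2, p.1)) lAB) => [[x y] []//|];
    move=> [x y] [x' y'] _ _ [-> ->].
move=> CD lCD; have [[c d] [/= Cc Dd]] := infinite_setN0 (large_infinite lCD).
have [i [iD iinj]] := card_leE d CD.
have [finD|/sq[F [FD Finj]]] := pselect (finite_set D).
  have := large_infinite lCD; case; apply: finite_setX => //.
  exact: card_le_finite finD.
apply: (large_inj (e := fun p => F (i p.1) p.2) lCD).
  by move=> [x y] [/= Cx Dy]; apply: FD => //; exact: iD.
move=> [x y] [x' y'] [/= Cx Dy] [/= Cx' Dy'].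
by move=> /Finj[]//; [exact: iD|exact: iD|move=> /iinj -> // ->].
Qed.

End Large.

(** * Finite sets *)

Lemma finite_sub_card (T : Type) (A B : set T) :
  finite_set B -> A `<=` B -> B #<= A -> B `<=` A.
Proof.
elim/Pchoice: T => T in A B *.
move=> finB AB BA.
have finA : finite_set A by exact: sub_finite_set finB.
have : fset_set A == fset_set B.
  rewrite eqEfcard; apply/andP; split; first by rewrite -fset_set_sub.
  have /finite_setP[n An] := finA.
  rewrite (card_fset_set An); apply: geq_card_fset_set.
  by rewrite -(card_le_eqr An).
by move=> /eqP /(fset_set_inj finA finB) <-.
Qed.

(** Choosing preimages maps h A back into A, and a finite A of the same
    cardinality leaves no point of A unchosen. *)
Lemma finite_image_inj (T U : Type) (A : set T) (h : T -> U) :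
  finite_set A -> A #<= h @` A -> inj_on A h.
Proof.
move=> finA cardA x y Ax Ay hxy.
have /choice[s sP] z : exists w, (h @` A) z -> A w /\ h w = z.
  have [[w Aw <-]|n] := pselect ((h @` A) z); first by exists w.
  by exists x.
have sA : s @` (h @` A) `<=` A by move=> _ [z hAz <-]; have [] := sP z hAz.
have As : A `<=` s @` (h @` A).
  apply: finite_sub_card => //; apply: card_le_trans cardA _.
  apply: (card_leI (e := s)) => [z hz|z z' /sP[_ hs] /sP[_ hs'] ss].
    by exists z.
  by rewrite -hs -hs' ss.
have sh w : A w -> s (h w) = w.
  by move=> /As[z hz <-]; have [_ ->] := sP z hz.
by rewrite -(sh x) // -(sh y) // hxy.
Qed.

Lemma finite_min_card (X T : Type) (P : X -> Prop) (B : X -> set T) (x0 : X) :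
  P x0 -> finite_set (B x0) ->
  exists x, [/\ P x, finite_set (B x) & forall y, P y -> B x #<= B y].
Proof.
move=> Px0 [n0 Bx0].
have ex0 : exists n, `[< exists x, P x /\ B x #= `I_n >].
  by exists n0; apply/asboolP; exists x0.
case: (ex_minnP ex0) => n /asboolP[x [Px Bx]] minn.
exists x; split=> //; first by exists n.
move=> y Py; have [[m By]|infBy] := pselect (finite_set (B y)).
  rewrite (card_le_eql Bx) (card_le_eqr By) card_le_II; apply: minn.
  by apply/asboolP; exists y.
have [//|yx] := card_le_total (B x) (B y).
by case: infBy; apply: card_le_finite yx _; exists n.
Qed.

(** * Permutations with prescribed values *)

Section Stabilisers.
Context {Omega : Type} (Omega_inf : infinite_set [set: Omega]).
Context (Sigma : set Omega) (Sigma_fin : finite_set Sigma).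
Local Notation large := (large Omega).

(** Removing Sigma from the two complements leaves large sets. These are
    equipotent, so the matching, extended by the identity on Sigma, can be
    completed to a bijection. *)
Lemma match_stab (I : Type) (X : set I) (e e' : I -> Omega) :
  inj_on X e -> inj_on X e' ->
  (forall i, X i -> ~ Sigma (e i)) -> (forall i, X i -> ~ Sigma (e' i)) ->
  large (~` (e @` X)) -> large (~` (e' @` X)) ->
  exists2 a, pointwise_stab Sigma a & forall i, X i -> a (e i) = e' i.
Proof.
move=> einj e'inj eS e'S le le'.
have /choice[h hP] y : exists z,
    (forall i, X i -> e i = y -> z = e' i) /\ (Sigma y -> z = y).
  have [[i Xi <-]|n] := pselect ((e @` X) y).
    by exists (e' i); split=> [j Xj /(einj _ _ Xj Xi)->|/(eS _ Xi)].
  by exists y; split=> // i Xi ei; case: n; exists i.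
have he i : X i -> h (e i) = e' i by move=> Xi; have [+ _] := hP (e i); apply.
have hS y : Sigma y -> h y = y by move=> Sy; have [_] := hP y; apply.
have : set_bij (e @` X `|` Sigma) (e' @` X `|` Sigma) h.
  split.
  - move=> y [[i Xi <-]|Sy]; first by left; rewrite he //; exists i.
    by right; rewrite hS.
  - move=> y z; rewrite !inE => -[[i Xi <-]|Sy] [[j Xj <-]|Sz].
    + by rewrite !he // => /e'inj->.
    + by rewrite he // hS // => e'z; case: (e'S _ Xi); rewrite e'z.
    + by rewrite he // hS // => e'z; case: (e'S _ Xj); rewrite -e'z.
    + by rewrite !hS.
  - move=> y [[i Xi <-]|Sy]; last by exists y; [right|exact: hS].
    by exists (e i); [left; exists i|exact: he].
have cardC (A : set Omega) : large (~` A) ->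
    [set: Omega] `\` (A `|` Sigma) #= [set: Omega].
  move=> lA; apply/large_card; rewrite setTD setCU.
  by rewrite -setDE; exact: large_setDfin.
move=> /Pbij[b hb]; have [|k kb] := super_bij b (@subsetT _ _) (@subsetT _ _).
  rewrite (card_eql (cardC _ le)); apply: card_esym.
  exact: cardC.
have kh y : (e @` X `|` Sigma) y -> k y = h y.
  by move=> Xy; rewrite kb ?hb // inE.
exists k; first split.
- exact: bijTT.
- by move=> y Sy; rewrite kh ?hS //; right.
- by move=> i Xi; rewrite kh ?he //; left; exists i.
Qed.

(** A is sent into one half of S, so that the other half keeps the complement of
    the image large. *)
Lemma move_stab (A S : set Omega) :
  (forall x, A x -> ~ Sigma x) -> large (~` A) -> large S ->
  exists2 a, pointwise_stab Sigma a & forall x, A x -> S (a x).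
Proof.
move=> AS lA lS; have lSS := large_setDfin Omega_inf lS Sigma_fin.
have [e [einj eS le]] := large_split Omega_inf lSS.
have [||||||a stab aE] := @match_stab _ A id e => //.
- by move=> x y _ _ /einj.
- by move=> x _; have [] := eS x.
- by rewrite image_id.
- by apply: largeS le => y [_ ney] [x _ ey]; apply: ney; exists x.
by exists a => // x Ax; rewrite aE //; have [] := eS x.
Qed.

End Stabilisers.

Lemma Sym_bij (Omega : Type) (a : Omega -> Omega) :
  Sym a -> injective a /\ forall y, exists x, a x = y.
Proof.
move=> bija; split; first exact: bij_inj.
by move=> y; case: bija => b _ ba; exists (b y).
Qed.

(** * Necessity of the conditions *)

Lemma generated_closed (Omega : Type) (A : set (Omega -> Omega)) :
  subsemigroup (generated A).
Proof.
move=> u v Uu Uv B [Bsub AB]; apply: (Bsub) => //; [exact: Uu|exact: Uv].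
Qed.

Lemma generated_full (Omega : Type) (G : set (Omega -> Omega))
    (f g : Omega -> Omega) (S : set (Omega -> Omega)) :
  generated (G `|` [set f; g]) = [set: Omega -> Omega] ->
  subsemigroup S -> (forall a, G a -> S a) -> S f -> S g -> forall h, S h.
Proof.
move=> gen Ssub GS Sf Sg h; have : [set: Omega -> Omega] h by [].
rewrite -gen; apply: smallest_sub => // u [/GS//|[->|->]]//.
Qed.

Section Generation.
Context {Omega : Type} (Omega_inf : infinite_set [set: Omega]).
Local Notation large := (large Omega).

Lemma exists_large_fibres :
  exists h : Omega -> Omega, forall x, large (fibre h x).
Proof.
have [F Finj] := exists_pairing Omega_inf.
have [x0 _] := infinite_setN0 Omega_inf.
have F2inj : inj_on setT (fun p => F p.1 p.2).
  by move=> [x y] [x' y'] _ _ /Finj [/= -> ->].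
have [r rE] := inj_on_retract (x0, x0) F2inj.
exists (fun y => (r y).1) => x; apply/largeP; exists (F x); split.
  by move=> y y' /Finj[].
by move=> y; rewrite /fibre /= (rE (x, y)).
Qed.

Lemma exists_inj_large_defect : exists h : Omega -> Omega,
  injective h /\ large (~` range h).
Proof.
have [e [einj _ le]] := large_split Omega_inf (large_setT (Omega:=Omega)).
by exists e; split=> //; apply: largeS le => x [].
Qed.

Section Generated.
Context (f g : Omega -> Omega).
Context (gen : generated (@Sym Omega `|` [set f; g]) = [set: Omega -> Omega]).

(** In a word for an injective map that is not a permutation, the first letter
    that is not a permutation is injective. *)
Lemma gen_inj_not_sym :
  (injective f /\ ~ Sym f) \/ (injective g /\ ~ Sym g).
Proof.
have [h [hinj lh]] := exists_inj_large_defect.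
apply: contrapT => /not_orP[nf ng].
have : forall h : Omega -> Omega, injective h -> Sym h.
  apply: (generated_full gen).
  - move=> u v Su Sv vuinj.
    have uinj : injective u by exact: (inj_compr vuinj).
    have Symu := Su uinj; have [_ usurj] := Sym_bij Symu.
    apply: bij_comp Symu; apply: Sv => x y.
    have [x' <-] := usurj x; have [y' <-] := usurj y.
    by move=> /vuinj ->.
  - by [].
  - by move=> finj; apply: contrapT => nS; apply: nf.
  - by move=> ginj; apply: contrapT => nS; apply: ng.
move=> /(_ h hinj) /Sym_bij[_ hsurj].
have [x hx] := infinite_setN0 (large_infinite Omega_inf lh).
by have [y hy] := hsurj x; apply: hx; exists y.
Qed.

(** In a word for a surjective map, the last such letter is surjective. *)
Lemma gen_surj_not_sym :
  ((forall y, exists x, f x = y) /\ ~ Sym f) \/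
  ((forall y, exists x, g x = y) /\ ~ Sym g).
Proof.
have [h hl] := exists_large_fibres.
apply: contrapT => /not_orP[nf ng].
have : forall h : Omega -> Omega, (forall y, exists x, h x = y) -> Sym h.
  apply: (generated_full gen).
  - move=> u v Su Sv vusurj.
    have Symv : Sym v by apply: Sv => y; have [x] := vusurj y; exists (u x).
    have [vinj _] := Sym_bij Symv.
    apply: bij_comp Symv _; apply: Su => y.
    by have [x /vinj] := vusurj (v y); exists x.
  - by [].
  - by move=> fs; apply: contrapT => nS; apply: nf.
  - by move=> gs; apply: contrapT => nS; apply: ng.
move=> /(_ h) []; first by move=> y; have [x] := infinite_setN0 (large_infinite Omega_inf (hl y)); exists x.
move=> k hk kh.
have [x0 _] := infinite_setN0 Omega_inf.
apply: (large_infinite Omega_inf (hl x0)).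
apply: (sub_finite_set _ (finite_set1 (k x0))) => x /= <-.
by rewrite hk.
Qed.

End Generated.

(** An injection of Omega into X pulls a cover of X by few small sets back to
    such a cover of Omega. *)
Lemma singular_cover (I X : set Omega) (F : Omega -> set Omega) :
  ~ large I -> (forall i, I i -> ~ large (F i)) -> large X ->
  (forall x, X x -> exists2 i, I i & F i x) -> singular_card Omega.
Proof.
move=> nI nF /largeP[e [einj eX]] XF; split=> //.
exists I, (fun i => e @^-1` (F i)); split.
- exact/card_ltE.
- move=> i Ii; apply/card_ltE => lFi; apply: (nF i Ii).
  by apply: (large_inj (e := e) lFi) => [x //|x y _ _ /einj].
- apply/seteqP; split=> // x _; have [i Ii Fi] := XF _ (eX x).
  by exists i.
Qed.

Section Necessity.
Context (f g : Omega -> Omega).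
Context (gen : generated (@Sym Omega `|` [set f; g]) = [set: Omega -> Omega]).
Context (finj : injective f) (gsurj : forall y, exists x, g x = y).

(** A point outside the range of a composite is outside the range of the second
    map, or is the image of a point outside the range of the first. *)
Lemma gen_defect : large (defect_set f).
Proof.
apply: contrapT => nf; have [h [hinj lh]] := exists_inj_large_defect.
suff : forall h : Omega -> Omega, ~ large (~` range h) by move=> /(_ h).
have nsurj (h' : Omega -> Omega) :
    (forall y, exists x, h' x = y) -> ~ large (~` range h').
  move=> h'surj /(large_infinite Omega_inf) /infinite_setN0[y ny].
  by have [x hx] := h'surj y; apply: ny; exists x.
apply: (generated_full gen) => //.
- move=> u v nu nv luv; apply: nu; apply: (large_image (h := v)).
  have [//|//] : large (~` range v) \/ large (v @` (~` range u)).
  apply: large_setU => //; apply: largeS luv => y nvu.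
  have [[x _ xy]|] := pselect (range v y); [right|by left].
  by exists x => // -[z _ zx]; apply: nvu; exists z => //=; rewrite zx.
- by move=> a /Sym_bij[_ /nsurj].
- exact: nsurj.
Qed.

Lemma fibre_comp (u v : Omega -> Omega) x y :
  fibre (v \o u) x y <-> exists2 z, fibre v x z & fibre u z y.
Proof. by split=> [vuy|[z <- <-]] //; exists (u y). Qed.

Lemma inj_fibre_finite (u : Omega -> Omega) x :
  injective u -> forall y, fibre u x y -> fibre u x `<=` [set y].
Proof. by move=> uinj y /= <- z /uinj. Qed.

(** A large fibre of v \o u is the union of the fibres of u over a fibre of v;
    by regularity, that fibre of v or one of those fibres of u is large. *)
Lemma gen_kset_regular : ~ singular_card Omega ->
  large (kset g [set: Omega]).
Proof.
move=> nsing; apply: contrapT => ng; have [h hl] := exists_large_fibres.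
suff : forall h : Omega -> Omega, ~ large (kset h [set: Omega]).
  move=> /(_ h); apply; apply: largeS (large_setT (Omega:=Omega)) => x _.
  exact: hl.
have ninj (u : Omega -> Omega) : injective u -> ~ large (kset u [set: Omega]).
  move=> uinj /(large_infinite Omega_inf) /infinite_setN0[x lx].
  apply: (large_infinite Omega_inf lx).
  have [y yx] := infinite_setN0 (large_infinite Omega_inf lx).
  exact: sub_finite_set (inj_fibre_finite uinj yx) (finite_set1 y).
apply: (generated_full gen) => //.
- move=> u v nu nv luv; apply: nu; apply: (large_image (h := v)).
  have [//|//] : large (kset v [set: Omega]) \/
      large (v @` (kset u [set: Omega])).
  apply: large_setU => //; apply: largeS luv => x lx.
  apply: contrapT => /not_orP[nvx nux]; apply: nsing.
  apply: (singular_cover (I := fibre v x) (F := fibre u) nvx _ lx).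
    by move=> z vz lz; apply: nux; exists z.
  by move=> y /fibre_comp[z]; exists z.
- by move=> a /Sym_bij[/ninj].
- exact: ninj.
Qed.

(** The maps all but few of whose fibres are bounded by one cardinal below the
    full one form a semigroup, because bounds multiply under composition. *)
Lemma gen_kset_small (N : set Omega) : card_lt N [set: Omega] ->
  large (kset g N).
Proof.
move=> ltN; apply: contrapT => ng; have [h hl] := exists_large_fibres.
have [x0 _] := infinite_setN0 Omega_inf.
suff : forall h : Omega -> Omega, exists M : set Omega,
    ~ large M /\ ~ large [set x | ~ (fibre h x #<= M)].
  move=> /(_ h)[M [nM]]; apply; apply: largeS (large_setT (Omega:=Omega)).
  by move=> x _ /= xM; apply: nM; exact: card_le_trans (hl x) xM.
have ninj (u : Omega -> Omega) : injective u -> exists M : set Omega,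
    ~ large M /\ ~ large [set x | ~ (fibre u x #<= M)].
  move=> uinj; exists [set x0]; split.
    by move=> /(large_infinite Omega_inf); apply.
  move=> /(large_infinite Omega_inf) /infinite_setN0[x]; apply.
  apply: (card_leI (e := fun _ => x0)) => // y z /= <- zy _.
  by apply: uinj.
apply: (generated_full gen).
- move=> u v [M1 [nM1 nu]] [M2 [nM2 nv]].
  have [F Finj] := exists_pairing Omega_inf.
  exists ((fun p => F p.1 p.2) @` (M1 `*` M2)); split.
    by move=> /large_image /(large_setX Omega_inf) [].
  move=> luv; apply: nu; apply: (large_image (h := v)).
  have [//|//] : large [set x | ~ (fibre v x #<= M2)] \/
      large (v @` [set x | ~ (fibre u x #<= M1)]).
  apply: large_setU => //; apply: largeS luv => x /= lx.
  apply: contrapT => /not_orP[/contrapT/(card_leE x0)[j [jM jinj]] nux].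
  have /choice[k kP] z : exists k : Omega -> Omega, fibre v x z ->
      (forall y, fibre u z y -> M1 (k y)) /\ inj_on (fibre u z) k.
    have [vz|nvz] := pselect (fibre v x z); last by exists id.
    have [/(card_leE x0)[k kP]|nz] := pselect (fibre u z #<= M1).
      by exists k.
    by case: nux; exists z.
  apply: lx; apply: (card_leI (e := fun y => F (k (u y) y) (j (u y)))).
    move=> y vuy; exists (k (u y) y, j (u y)) => //; split; last exact: jM.
    by have [kM _] := kP _ vuy; apply: kM.
  move=> y y' vuy vuy' /Finj[+ /jinj uu].
  have {}uu : u y = u y' by exact: uu.
  by rewrite -uu; have [_ kinj] := kP _ vuy; apply: kinj.
- by move=> a /Sym_bij[/ninj].
- exact: ninj.
- exists N; split; first exact/card_ltE.
  move=> lN; apply: ng; apply: largeS lN => x /= nx.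
  by have [] := card_le_total (fibre g x) N.
Qed.

Lemma gen_parameters : parameter_conditions f g.
Proof.
split=> //.
- exact/large_card/gen_defect.
- by move=> y _; have [x] := gsurj y; exists x.
- have [sing|nsing] := pselect (singular_card Omega); [right|left].
    by split=> // N ltN; apply/large_card/gen_kset_small.
  by split=> //; apply/large_card/gen_kset_regular.
Qed.

End Necessity.

(** Every point of Gamma has a preimage, which lies in Gamma; so v maps the
    finite set Gamma onto a set that contains it. *)
Lemma finite_preimage_sub (Gamma : set Omega) (v : Omega -> Omega) :
  finite_set Gamma -> Gamma `<=` range v -> v @^-1` Gamma `<=` Gamma ->
  v @` Gamma `<=` Gamma /\ inj_on Gamma v.
Proof.
move=> finG Gv vG.
have Gimage : Gamma `<=` v @` Gamma.
  by move=> y Gy; have [x _ xy] := Gv y Gy; exists x => //; apply: vG; rewrite /= xy.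
split; first exact: finite_sub_card (finite_image _ finG) Gimage (card_image_le _ _).
exact: finite_image_inj finG (subset_card_le Gimage).
Qed.

Section Moving.
Context (Gamma : set Omega) (Gamma_fin : finite_set Gamma).
Context (Gamma_ne : Gamma !=set0) (f g : Omega -> Omega).
Context (gen : generated (setwise_stab Gamma `|` [set f; g])
                 = [set: Omega -> Omega]).

Lemma gen_not_image_sub : f @` Gamma `<=` Gamma -> ~ (g @` Gamma `<=` Gamma).
Proof.
move=> fG gG; have [x0 nx0] := infinite_setN0
  (large_infinite Omega_inf (large_setCfin Omega_inf Gamma_fin)).
suff /(_ (fun=> x0)) : forall h : Omega -> Omega, h @` Gamma `<=` Gamma.
  by have [x Gx] := Gamma_ne; move=> /(_ x0) H; apply: nx0; apply: H; exists x.
apply: (generated_full gen) => //; last by move=> a [_ ->].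
move=> u v uG vG _ [x Gx <-]; apply: vG; exists (u x) => //.
by apply: uG; exists x.
Qed.

Lemma gen_not_preimage_sub :
  f @^-1` Gamma `<=` Gamma -> ~ (g @^-1` Gamma `<=` Gamma).
Proof.
move=> fG gG; have [x0 nx0] := infinite_setN0
  (large_infinite Omega_inf (large_setCfin Omega_inf Gamma_fin)).
have [x1 Gx1] := Gamma_ne.
suff /(_ (fun=> x1)) : forall h : Omega -> Omega, h @^-1` Gamma `<=` Gamma.
  by move=> /(_ x0 Gx1).
apply: (generated_full gen) => //.
  by move=> u v uG vG x /vG /uG.
move=> a [Syma aG] x; rewrite /= -{1}aG => -[y Gy].
by have [ainj _] := Sym_bij Syma => /ainj <-.
Qed.

(** If g shrank Gamma, every generator, and then every map, would either shrink
    Gamma or map it into itself. *)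
Lemma gen_image_card : f @` Gamma `<=` Gamma -> g @` Gamma #= Gamma.
Proof.
move=> fG; apply/card_eqPle; split; first exact: card_image_le.
apply: contrapT => gG.
have /largeP[h [hinj hG]] := large_setCfin Omega_inf Gamma_fin.
suff /(_ h) : forall h : Omega -> Omega,
    Gamma #<= h @` Gamma -> h @` Gamma `<=` Gamma.
  move=> H; have [x Gx] := Gamma_ne; apply: (hG x); apply: H; last by exists x.
  by apply: (card_leI (e := h)) => [y Gy|y z _ _]; [exists y|exact: hinj].
apply: (generated_full gen) => //; first last.
- by move=> a [_ ->] _.
move=> u v uG vG cardG.
have {}uG : u @` Gamma `<=` Gamma.
  apply: uG; apply: card_le_trans cardG _.
  by rewrite -image_comp; exact: card_image_le.
have vuG : (v \o u) @` Gamma `<=` v @` Gamma.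
  by move=> _ [x Gx <-]; exists (u x) => //; apply: uG; exists x.
apply: subset_trans (vuG) (vG _).
exact: card_le_trans cardG (subset_card_le vuG).
Qed.

(** If f missed a point of Gamma, every generator, and then every map, would
    either miss a point of Gamma or have its preimage of Gamma inside Gamma. *)
Lemma gen_sub_range : g @^-1` Gamma `<=` Gamma -> Gamma `<=` range f.
Proof.
move=> gG; apply: contrapT => fG.
have [h hl] := exists_large_fibres.
suff /(_ h) : forall h : Omega -> Omega,
    Gamma `<=` range h -> h @^-1` Gamma `<=` Gamma.
  move=> H; have [x Gx] := Gamma_ne.
  apply: (large_infinite Omega_inf (hl x)); apply: sub_finite_set Gamma_fin.
  apply: subset_trans (H _) => [y /= ->//|y Gy].
  by have [z hz] := infinite_setN0 (large_infinite Omega_inf (hl y)); exists z.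
apply: (generated_full gen) => //; last first.
  move=> a [Syma aG] _ x; rewrite /= -{1}aG => -[y Gy].
  by have [ainj _] := Sym_bij Syma => /ainj <-.
move=> u v uG vG Gvu.
have Gv : Gamma `<=` range v by move=> y /Gvu[x _ <-]; exists (u x).
have {}vG := vG Gv.
have [vGG vinj] := finite_preimage_sub Gamma_fin Gv vG.
have Gu : Gamma `<=` range u.
  move=> y Gy; have Gvy : Gamma (v y) by apply: vGG; exists y.
  have [x _ /= xy] := Gvu _ Gvy; exists x => //.
  by apply: vinj => //; apply: vG; rewrite /= xy.
by move=> x /vG /(uG Gu).
Qed.

Lemma gen_moving : (forall y, exists x, g x = y) ->
  moving_conditions f g Gamma.
Proof.
move=> gsurj; have Gg : Gamma `<=` range g.
  by move=> y _; have [x xy] := gsurj y; exists x.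
have [fG|nfG] := pselect (f @` Gamma `<=` Gamma).
  have ngG := gen_not_image_sub fG.
  apply: Or32; split=> //; last exact: gen_image_card.
  by move=> gG; have [] := finite_preimage_sub Gamma_fin Gg gG.
have [gG|ngG] := pselect (g @^-1` Gamma `<=` Gamma); last exact: Or31.
apply: Or33; split=> //; last exact: gen_sub_range.
by move=> fG; apply: (gen_not_preimage_sub fG).
Qed.

End Moving.

Lemma inj_surj_Sym (h : Omega -> Omega) :
  injective h -> (forall y, exists x, h x = y) -> Sym h.
Proof.
move=> hinj /section[s hs]; exists s => // x; apply: hinj; exact: hs.
Qed.

Lemma setwise_gen_condition_III (Sigma : set Omega) (f g : Omega -> Omega) :
  finite_set Sigma ->
  (forall Gamma : set Omega, Gamma `<=` Sigma ->
     generated (setwise_stab Gamma `|` [set f; g]) = [set: Omega -> Omega]) ->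
  condition_III Sigma f g \/ condition_III Sigma g f.
Proof.
move=> finS gen.
have symgen : generated (@Sym Omega `|` [set f; g]) = [set: Omega -> Omega].
  apply/seteqP; split=> // h _; have : [set: Omega -> Omega] h by [].
  rewrite -(gen set0 (@sub0set _ _)); apply: sub_smallest2r.
    exact: generated_closed.
  by move=> u [[Symu _]|fgu]; [left|right].
have key (f' g' : Omega -> Omega) : [set f'; g'] = [set f; g] ->
    injective f' -> (forall y, exists x, g' x = y) -> condition_III Sigma f' g'.
  move=> e finj gsurj; split; first by apply: gen_parameters; rewrite // e.
  move=> Gamma neG GS; apply: gen_moving => //; first exact: sub_finite_set finS.
  by rewrite e; exact: gen.
have [[finj nf]|[ginj ng]] := gen_inj_not_sym symgen;
  have [[fsurj nf']|[gsurj ng']] := gen_surj_not_sym symgen.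
- by case: nf; exact: inj_surj_Sym.
- by left; apply: key.
- by right; apply: key; rewrite // setUC.
- by case: ng; exact: inj_surj_Sym.
Qed.

End Generation.

(** * From the conditions to the full semigroup *)

Section Sufficiency.
Context {Omega : Type} (Omega_inf : infinite_set [set: Omega]).
Context (Sigma : set Omega) (Sigma_fin : finite_set Sigma).
Context (U : set (Omega -> Omega)) (Usub : subsemigroup U).
Context (Ustab : pointwise_stab Sigma `<=` U).
Context (f g : Omega -> Omega) (Uf : U f) (Ug : U g).
Context (finj : injective f) (gsurj : forall y, exists x, g x = y).
Local Notation large := (large Omega).

Lemma finite_preimage_inj (h : Omega -> Omega) (A : set Omega) :
  injective h -> finite_set A -> finite_set (h @^-1` A).
Proof. by move=> hinj; apply: finite_preimage => x y _ _ /hinj. Qed.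

Section AvoidSigma.
Context (f_defect : large (~` range f)).
Context (moving : forall Gamma : set Omega, Gamma !=set0 -> Gamma `<=` Sigma ->
  ~ (f @` Gamma `<=` Gamma) \/
  (~ (g @` Gamma `<=` Gamma) /\ g @` Gamma #= Gamma)).

Let nice (p : Omega -> Omega) :=
  [/\ U p, injective p & large (~` range p)].

Let hit (p : Omega -> Omega) : set Omega := range p `&` Sigma.

Let nice_comp u p : U u -> injective u -> nice p -> nice (p \o u).
Proof.
move=> Uu uinj [Up pinj lp]; split; first exact: Usub.
  exact: inj_comp.
by apply: largeS lp => y ny [x _ xy]; apply: ny; exists (u x).
Qed.

(** A map p that meets Sigma in as few points as possible meets it nowhere. A
    permutation a fixing Sigma can place the values of p outside Sigma as
    desired, so only the points of Gamma, the trace of the range on Sigma,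
    matter when p is followed by a and another map. *)
Lemma exists_injective_avoiding :
  exists p, [/\ U p, injective p, large (~` range p) &
              forall x, ~ Sigma (p x)].
Proof.
have finhit p : finite_set (hit p).
  by apply: sub_finite_set Sigma_fin => x [].
have nicef : nice f by [].
have [p [nicep _ minp]] := finite_min_card nicef (finhit f).
have [Up pinj lp] := nicep.
have [hit0|[x0 hitx0]] := pselect (forall x, ~ hit p x).
  by exists p; split=> // x Spx; apply: (hit0 (p x)); split.
exfalso.
move: minp; set Gamma := hit p => minp.
have finG : finite_set Gamma by exact: finhit.
have GS : Gamma `<=` Sigma by move=> x [].
pose A := range p `\` Sigma.
have AS x : A x -> ~ Sigma x by case.
have lA : large (~` A) by apply: largeS lp => x nx [].
have pA x : A (p x) \/ Gamma (p x).
  by have [?|?] := pselect (Sigma (p x)); [right|left]; split=> //; exists x.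
have stabG a x : pointwise_stab Sigma a -> Gamma x -> a x = x.
  by move=> [_ aS] /GS /aS.
have stab_inj a : pointwise_stab Sigma a -> injective a.
  by move=> [/Sym_bij[]].
(* Following p by a permutation that keeps its other values away from the
   preimage of Sigma, and then by p again, meets Sigma in p Gamma at most. *)
have pG : Gamma `<=` p @` Gamma.
  have lS : large (~` (p @^-1` Sigma)).
    exact: large_setCfin (finite_preimage_inj pinj Sigma_fin).
  have [a astab aA] := move_stab Omega_inf Sigma_fin AS lA lS.
  have sub : hit (p \o (a \o p)) `<=` p @` Gamma `&` Sigma.
    move=> _ [[x _ <-] /= Sx]; split=> //.
    have [/aA//|Gx] := pA x.
    by rewrite (stabG a) //; exists (p x).
  have nicepap : nice (p \o (a \o p)).
    apply: nice_comp => //; first by apply: Usub => //; exact: Ustab.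
    by apply: inj_comp => //; exact: stab_inj.
  have sub' : p @` Gamma `&` Sigma `<=` Gamma.
    by move=> _ [[x _ <-] Sx]; split=> //; exists x.
  apply: subset_trans (@subIsetl _ _ Sigma).
  apply: finite_sub_card => //.
  exact: card_le_trans (minp _ nicepap) (subset_card_le sub).
have pGe : p @` Gamma `<=` Gamma.
  apply: finite_sub_card => //; first exact: finite_image.
  exact: card_image_le.
have preS x : Sigma (p x) -> Gamma x.
  move=> Sx; have : Gamma (p x) by split=> //; exists x.
  by move=> /pG[y Gy /pinj <-].
(* Minimality is now used against maps p \o u, whose range meets Sigma in the
   p-image of the part of Gamma met by the range of u. *)
have covers u : U u -> injective u -> Gamma `<=` range u.
  move=> Uu uinj.
  have sub : hit (p \o u) `<=` p @` (range u `&` Gamma).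
    move=> _ [[x _ <-] /= Sx]; exists (u x) => //; split; first by exists x.
    exact: preS.
  have cardG : Gamma #<= range u `&` Gamma.
    apply: card_le_trans (minp _ (nice_comp Uu uinj nicep)) _.
    exact: card_le_trans (subset_card_le sub) (card_image_le _ _).
  apply: subset_trans (@subIsetl _ _ Gamma).
  by apply: finite_sub_card.
have [nfG|[ngG gG]] := moving (ex_intro _ x0 hitx0) GS.
  have lS : large (~` (f @^-1` Gamma)).
    exact: large_setCfin (finite_preimage_inj finj finG).
  have [a astab aA] := move_stab Omega_inf Sigma_fin AS lA lS.
  apply: nfG; apply: finite_sub_card; first exact: finite_image.
    move=> y Gy; have [||x _ /= xy] := covers (f \o (a \o p)) _ _ y Gy.
    - by apply: Usub => //; apply: Usub => //; exact: Ustab.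
    - by apply: inj_comp => //; apply: inj_comp => //; exact: stab_inj.
    have [/aA|Gx] := pA x; first by rewrite /= xy.
    by exists (p x) => //; rewrite -xy (stabG a).
  exact: card_image_le.
(* For u ending in g, the permutation sends the values of p outside Sigma to a
   transversal of the fibres of g that lie over no point of Gamma or g Sigma;
   this makes u injective, and no point of Gamma outside g Gamma is reached. *)
have [s sg] := section gsurj.
have ginj : inj_on Gamma g.
  by apply: finite_image_inj => //; move: gG => /card_eqPle[].
have sinj : injective s by exact: can_inj sg.
pose S := s @` (~` (Gamma `|` g @` Sigma)).
have lS : large S.
  apply: (large_inj (A := ~` (Gamma `|` g @` Sigma)) (e := s)).
  - apply: large_setCfin => //; rewrite finite_setU; split=> //.
    exact: finite_image.
  - by move=> x; exists x.
  - by move=> x y _ _ /sinj.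
have [a astab aA] := move_stab Omega_inf Sigma_fin AS lA lS.
have apP x : (exists2 z, ~ (Gamma `|` g @` Sigma) z & a (p x) = s z) \/
    (Gamma (p x) /\ a (p x) = p x).
  have [/aA[z nz <-]|Gx] := pA x; first by left; exists z.
  by right; rewrite (stabG a).
apply: ngG; apply: finite_sub_card; first exact: finite_image.
  move=> y Gy; have [||x _ /= xy] := covers (g \o (a \o p)) _ _ y Gy.
  - by apply: Usub => //; apply: Usub => //; exact: Ustab.
  - move=> x x' /= e; apply: pinj; apply: (stab_inj a) => //; move: e.
    have [[z nz ->]|[Gx ->]] := apP x; have [[z' nz' ->]|[Gx' ->]] := apP x'.
    + by rewrite !sg => ->.
    + rewrite sg => e; case: nz; right; exists (p x') => //; exact: GS.
    + rewrite sg => e; case: nz'; right; exists (p x) => //; exact: GS.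
    + exact: ginj.
  move: xy; have [[z nz ->]|[Gx ->]] := apP x => xy; last by exists (p x).
  by case: nz; left; rewrite -(sg z) xy.
exact: card_image_le.
Qed.

End AvoidSigma.

Section LargeFibres.
Context (gpar : (regular_card Omega /\ kset g [set: Omega] #= [set: Omega]) \/
      (singular_card Omega /\
       forall N : set Omega, card_lt N [set: Omega] ->
         kset g N #= [set: Omega])).
Context (moving : forall Gamma : set Omega, Gamma !=set0 -> Gamma `<=` Sigma ->
  ~ (g @^-1` Gamma `<=` Gamma) \/
  (~ (f @^-1` Gamma `<=` Gamma) /\ Gamma `<=` range f)).

Let surj (h : Omega -> Omega) := forall y, exists x, h x = y.

Let surj_comp u v : surj u -> surj v -> surj (v \o u).
Proof.
by move=> us vs y; have [x <-] := vs y; have [z <-] := us x; exists z.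
Qed.

Let stab_surj a : pointwise_stab Sigma a -> surj a.
Proof. by move=> [/Sym_bij[]]. Qed.

Lemma kset_large (N : set Omega) : ~ large N -> large (kset g N).
Proof.
move=> nN; case: gpar => [[_ /large_card lg]|[_ lg]].
  apply: largeS lg => x lx; exact: card_le_trans (card_leT N) lx.
by apply/large_card; apply: lg; apply/card_ltE.
Qed.

(** A large set of points have a fibre under g with two points or more, and s
    misses a point of each such fibre. *)
Lemma section_defect s : cancel s g -> large (~` range s).
Proof.
move=> sg; have [c1 _] := infinite_setN0 Omega_inf.
have [c2 [_ c2N]] := infinite_setN0 (infinite_setD Omega_inf (finite_set1 c1)).
have lK : large (kset g [set c1; c2]).
  by apply: kset_large => /(large_infinite Omega_inf); apply; exact: finite_set2.
have /choice[t tP] x : exists y, kset g [set c1; c2] x -> g y = x /\ y <> s x.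
  have [/(card_leE c1)[e [ex einj]]|n] := pselect (kset g [set c1; c2] x);
    last by exists x.
  have [e1|ne1] := pselect (e c1 = s x); last first.
    by exists (e c1) => _; split=> //; apply: ex; left.
  exists (e c2) => _; split; first by apply: ex; right.
  move=> e2; apply: c2N; apply/esym; apply: einj; [by left|by right|].
  by rewrite e1 e2.
apply: (large_inj (e := t) lK) => [x /tP[gt nt] [y _ ys]|x y /tP[tx _] /tP[ty _] txy].
  by apply: nt; rewrite -ys -[in RHS]gt -ys sg.
by rewrite -tx -ty txy.
Qed.

(** If |Omega| is regular, g will do. If Omega is the union of few small sets
    F i, take a maximal collection of disjoint families of points, where the
    i-th point of a family has a fibre of size at least |F i|. The collection is
    large: otherwise it covers few points, and another family can be found among
    the rest. A permutation moves each family into one fibre of g. In the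
    composite of g, this permutation and g, the fibre over the corresponding
    point has room for every F i, so it is large. *)
Lemma exists_large_kset : exists g1,
  [/\ U g1, surj g1 & large [set x | large (fibre g1 x)]].
Proof.
case: gpar => [[_ /large_card lg]|[[_ [I [F [ltI ltF IF]]]] _]]; first by exists g.
have nI : ~ large I by apply/card_ltE.
have nF i : I i -> ~ large (F i) by move=> Ii; apply/card_ltE; exact: ltF.
have [x0 _] := infinite_setN0 Omega_inf.
have [i0 Ii0 _] : (\bigcup_(i in I) F i) x0 by rewrite IF.
pose K i := kset g (F i) `\` Sigma.
have lK i : I i -> large (K i).
  by move=> Ii; apply: large_setDfin => //; apply: kset_large; exact: nF.
pose D : set (Omega -> Omega) := [set phi | forall i, I i -> K i (phi i)].
have [E [ED Edisj Emax]] :=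
  ex_maximal_disjoint_subcollection (fun phi : Omega -> Omega => phi @` I) D.
have Einj phi phi' i i' : E phi -> E phi' -> I i -> I i' ->
    phi i = phi' i' -> phi = phi'.
  move=> Ephi Ephi' Ii Ii' e; apply: Edisj => //.
  by exists (phi i); split; [exists i|rewrite e; exists i'].
have lE : large E.
  apply: contrapT => nE.
  pose C := [set y | exists phi i, [/\ E phi, I i & y = phi i]].
  have nC : ~ large C.
    move=> lC; have [//|//] : large E \/ large I.
    apply: (large_setX Omega_inf).
    apply: (large_image (h := fun p => p.1 p.2)).
    apply: largeS lC => _ [phi [i [Ephi Ii ->]]].
    by exists (phi, i).
  have /choice[phi0 phi0P] i : exists y, I i -> K i y /\ ~ C y.
    have [Ii|nIi] := pselect (I i); last by exists x0.
    have [y Ky] := infinite_setN0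
      (large_infinite Omega_inf (large_setD Omega_inf (lK _ Ii) nC)).
    by exists y.
  have nE0 : ~ E phi0.
    by move=> E0; have [_] := phi0P _ Ii0; apply; exists phi0, i0.
  apply: (Emax (E `|` [set phi0])).
  - split; first by left.
    by move=> /(_ phi0 (or_intror erefl)).
  - by move=> phi [/ED//|->] i /phi0P[].
  - have disj phi : E phi -> ~ (phi @` I `&` phi0 @` I !=set0).
      move=> Ephi [_ [[i Ii <-] [j Ij e]]].
      by have [_] := phi0P _ Ij; apply; exists phi, i.
    move=> phi phi' [Ephi|->] [Ephi'|->] //; first exact: Edisj.
      by move=> /(disj _ Ephi).
    by rewrite setIC => /(disj _ Ephi').
have [m [minj mE lm]] := large_split Omega_inf lE.
have lT : large (kset g I `\` g @` Sigma).
  by apply: large_setDfin; [|exact: kset_large|exact: finite_image].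
have [w [winj wT lw]] := large_split Omega_inf lT.
have /choice[psi psiP] z : exists psi : Omega -> Omega,
    (forall i, I i -> g (psi i) = w z) /\ inj_on I psi.
  by have [/(card_leE x0)] := wT z.
have /choice[rep repP] z : exists rep : Omega -> Omega, forall y,
    (m z @` I) y -> I (rep y) /\ m z (rep y) = y.
  have /choice[r rP] y : exists i, (m z @` I) y -> I i /\ m z i = y.
    have [[i Ii <-]|n] := pselect ((m z @` I) y); first by exists i.
    by exists x0.
  by exists r.
(* A family may take one value at several indices; X keeps one of them. *)
pose X : set (Omega * Omega) := [set p | I p.2 /\ rep p.1 (m p.1 p.2) = p.2].
have Xrep z i : I i -> X (z, rep z (m z i)) /\ m z (rep z (m z i)) = m z i.
  move=> Ii; have [|Ir mr] := repP z (m z i); first by exists i.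
  by split=> //; split=> //=; rewrite mr.
have [s sg] := section gsurj.
have sinj : injective s by exact: can_inj sg.
have [|||||| a astab aE] := @match_stab Omega Omega_inf Sigma Sigma_fin
    (Omega * Omega)%type X (fun p => m p.1 p.2) (fun p => psi p.1 p.2).
- move=> [z i] [z' i'] [/= Ii ri] [/= Ii' ri'] e.
  have zz : z = z' by apply: minj; exact: Einj (mE z) (mE z') Ii Ii' e.
  by subst; rewrite -ri -ri' e.
- move=> [z i] [z' i'] [/= Ii _] [/= Ii' _] e.
  have [gz psiinj] := psiP z; have [gz' _] := psiP z'.
  have zz : z = z' by apply: winj; rewrite -(gz _ Ii) -(gz' _ Ii') e.
  by subst; rewrite (psiinj _ _ Ii Ii' e).
- by move=> [z i] [/= Ii _]; have [] := ED _ (mE z) _ Ii.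
- move=> [z i] [/= Ii _] Spsi; have [_] := wT z; apply.
  by exists (psi z i) => //; have [gz _] := psiP z; exact: gz.
- apply: (large_inj (e := fun phi : Omega -> Omega => phi i0) lm).
    move=> phi [Ephi nphi] [[z i] [/= Ii _] e]; apply: nphi; exists z => //.
    exact: Einj (mE z) Ephi Ii Ii0 e.
  by move=> phi phi' [Ephi _] [Ephi' _]; exact: Einj.
- apply: (large_inj (e := s) lw) => [x [_ nx] [[z i] [/= Ii _] e]|x y _ _ /sinj//].
  by apply: nx; exists z => //; have [gz _] := psiP z; rewrite -(gz _ Ii) e sg.
exists (g \o (a \o g)); split.
- by apply: Usub => //; apply: Usub => //; exact: Ustab.
- by apply: surj_comp => //; apply: surj_comp => //; exact: stab_surj.
have lrange : large (range w).
  by apply/largeP; exists w; split=> // x; exists x.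
apply: largeS lrange => _ [z _ <-] /=; apply: contrapT => nfib.
have : ~ large (I `*` fibre (g \o (a \o g)) (w z)).
  by move=> /(large_setX Omega_inf)[].
have Fz i : I i -> F i #<= fibre (g \o (a \o g)) (w z).
  move=> Ii; have [[Fi _] [Xi mi]] := (ED _ (mE z) _ Ii, Xrep z i Ii).
  apply: card_le_trans Fi _; apply: subset_card_le => y /= gy.
  rewrite /fibre /= gy -mi (aE _ Xi) /=; have [gz _] := psiP z; apply: gz.
  by have [] := Xi.
have /choice[k kP] i : exists k : Omega -> Omega, I i ->
    (forall x, F i x -> fibre (g \o (a \o g)) (w z) (k x)) /\ inj_on (F i) k.
  have [/Fz/(card_leE x0)[k kP]|nIi] := pselect (I i); last by exists id.
  by exists k.
have /choice[c cP] x : exists i, I i /\ F i x.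
  have [i Ii Fi] : (\bigcup_(i in I) F i) x by rewrite IF.
  by exists i.
(* Omega embeds in the product of I with the fibre, neither of which is large *)
apply; apply/largeP; exists (fun x => (c x, k (c x) x)); split.
  move=> x y [cxy]; rewrite -cxy => kxy; have [Ic Fx] := cP x.
  have [_ kinj] := kP _ Ic; apply: kinj => //.
  by rewrite cxy; have [] := cP y.
move=> x; have [Ic Fx] := cP x; split=> //=.
by have [kF _] := kP _ Ic; apply: kF.
Qed.

Let small_fibres (q : Omega -> Omega) : set Omega :=
  [set x | ~ large (fibre q x)].

Let nice (q : Omega -> Omega) := U q /\ surj q.

Let nice_comp u v : nice u -> nice v -> nice (v \o u).
Proof. by move=> [Uu us] [Uv vs]; split; [exact: Usub|exact: surj_comp]. Qed.

Let nice_stab a : pointwise_stab Sigma a -> nice a.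
Proof. by move=> astab; split; [exact: Ustab|exact: stab_surj]. Qed.

(** Each point x outside g Sigma has a preimage outside Sigma; a permutation
    puts there a point whose fibre under g1 is large. *)
Lemma exists_cofinite_large_fibres :
  exists q, nice q /\ finite_set (small_fibres q).
Proof.
have [g1 [Ug1 g1s lK]] := exists_large_kset.
have [s sg] := section gsurj.
have sinj : injective s by exact: can_inj sg.
have [e [einj eK le]] :=
  large_split Omega_inf (large_setDfin Omega_inf lK Sigma_fin).
have [|||||| a astab aE] := @match_stab Omega Omega_inf Sigma Sigma_fin
    Omega (~` (g @` Sigma)) e s.
- by move=> x y _ _ /einj.
- by move=> x y _ _ /sinj.
- by move=> x _; have [] := eK x.
- by move=> x nx Sx; apply: nx; exists (s x).
- by apply: largeS le => y [_ ny] [x _ ex]; apply: ny; exists x.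
- by apply: largeS (section_defect sg) => y ny [x _ ex]; apply: ny; exists x.
exists (g \o (a \o g1)); split.
  by apply: nice_comp => //; apply: nice_comp => //; exact: nice_stab.
apply: sub_finite_set (finite_image g Sigma_fin) => x nx.
apply: contrapT => nSx; apply: nx; have [ex _] := eK x.
by apply: largeS ex => y /= ye; rewrite /fibre /= ye aE // sg.
Qed.

(** Take q surjective with as few small fibres as possible, and let Gamma be the
    set of points below them. When q is followed by a surjective u, the fibre
    over x is large as soon as the fibre of u over x is not inside Gamma, so
    minimality bounds from below how many fibres of u lie inside Gamma. *)
Lemma exists_all_large_fibres : exists q, U q /\ forall x, large (fibre q x).
Proof.
have [q0 [niceq0 fin0]] := exists_cofinite_large_fibres.
have [q [niceq finG minq]] := finite_min_card niceq0 fin0.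
have [Uq qs] := niceq.
move: finG minq; set Gamma := small_fibres q => finG minq.
have nG x : ~ Gamma x -> large (fibre q x) by move=> /contrapT.
have [G0|[x0 Gx0]] := pselect (forall x, ~ Gamma x).
  by exists q; split=> // x; exact: nG.
exfalso.
pose inside (u : Omega -> Omega) := [set x | fibre u x `<=` Gamma].
have card_inside u : nice u -> Gamma #<= inside u.
  move=> niceu; apply: card_le_trans (minq _ (nice_comp niceq niceu)) _.
  apply: subset_card_le => x nx y uy; apply: contrapT => /nG ly; apply: nx.
  by apply: largeS ly => z /= qz; rewrite /fibre /= qz.
(* Take u to be a permutation followed by g, where the permutation moves the
   points of Gamma outside Sigma off the range of a section s of g. *)
have GS : Gamma `<=` Sigma.
  have [s sg] := section gsurj.
  have [||a astab aA] := move_stab Omega_inf Sigma_fin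
      (A := Gamma `\` Sigma) _ _ (section_defect sg).
  - by move=> x [].
  - exact: large_setCfin (finite_setD _ finG).
  have niceu : nice (g \o a) by apply: nice_comp => //; exact: nice_stab.
  have sinside x : inside (g \o a) x -> (Gamma `&` Sigma) (s x).
    move=> xin; have [y ay] := stab_surj astab (s x).
    have Gy : Gamma y by apply: xin; rewrite /fibre /= ay sg.
    have [Sy|nSy] := pselect (Sigma y).
      by have [_ aS] := astab; rewrite -ay aS.
    by case: (aA y); [|exists x].
  apply: subset_trans (@subIsetr _ Gamma _).
  apply: finite_sub_card => //.
  apply: card_le_trans (card_inside _ niceu) _.
  apply: (card_leI (e := s)) => // x y _ _; exact: can_inj.
have preG u : nice u -> (forall x, ~ Gamma x -> ~ inside u x) ->
    u @^-1` Gamma `<=` Gamma.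
  move=> niceu uG; have inG : inside u `<=` Gamma.
    by move=> x xin; apply: contrapT => /uG.
  have Gin : Gamma `<=` inside u by apply: finite_sub_card => //; exact: card_inside.
  by move=> y /Gin; apply.
have nlargeG (A : set Omega) : large A -> ~ (A `<=` Gamma).
  by move=> /(large_infinite Omega_inf) infA AG; apply: infA; exact: sub_finite_set finG.
have qG : q @^-1` Gamma `<=` Gamma.
  by apply: preG => // x /nG lx; exact: nlargeG.
have Gq : Gamma `<=` range q by move=> y _; have [x xy] := qs y; exists x.
have [qGG _] := finite_preimage_sub finG Gq qG.
have [ngG|[nfG Gf]] := moving (ex_intro _ x0 Gx0) GS.
  apply: ngG => y Gy; apply: (preG (q \o g)); last by apply: qGG; exists (g y).
    exact: nice_comp.
  move=> x /nG lx; apply: nlargeG.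
  have [s sg] := section gsurj.
  apply: (large_inj (e := s) lx) => [z qz|z z' _ _ /(can_inj sg)//].
  by rewrite /fibre /= sg.
(* Take u to be f, a permutation a and q, where a moves points f z, with z
   outside Gamma, into all the large fibres of q. *)
have lf : large (range f `\` (Sigma `|` f @` Gamma)).
  apply: large_setDfin => //; last first.
    by rewrite finite_setU; split=> //; exact: finite_image.
  by apply/largeP; exists f; split=> // x; exists x.
have [e [einj eR le]] := large_split Omega_inf lf.
have /choice[e' e'P] x : exists y, ~ Gamma x -> q y = x /\ ~ Sigma y.
  have [Gx|/nG lx] := pselect (Gamma x); first by exists x.
  have [y [qy Sy]] := infinite_setN0
    (large_infinite Omega_inf (large_setDfin Omega_inf lx Sigma_fin)).
  by exists y.
have [x1 nx1] := infinite_setN0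
  (large_infinite Omega_inf (large_setCfin Omega_inf finG)).
have [|||||| a astab aE] := @match_stab Omega Omega_inf Sigma Sigma_fin
    Omega (~` Gamma) e e'.
- by move=> x y _ _ /einj.
- by move=> x y /e'P[qx _] /e'P[qy _] exy; rewrite -qx -qy exy.
- by move=> x _ Sx; have [_] := eR x; apply; left.
- by move=> x /e'P[].
- by apply: largeS le => y [_ ny] [x _ ex]; apply: ny; exists x.
- apply: largeS (large_setDfin Omega_inf (nG _ nx1) (finite_set1 (e' x1))).
  move=> y [/= qy ny] [x nx e'x]; apply: ny; rewrite /= -e'x; congr e'.
  by have [qx _] := e'P _ nx; rewrite -qy -e'x qx.
have hitx x : ~ Gamma x -> exists2 z, ~ Gamma z & q (a (f z)) = x.
  move=> nx; have [[z _ fz] nfz] := eR x; exists z.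
    by move=> Gz; apply: nfz; right; exists z.
  by rewrite fz aE //; have [] := e'P _ nx.
have aG y : Gamma y -> a y = y by move=> /GS; have [_] := astab; apply.
have niceu : nice (q \o (a \o f)).
  split; first by apply: Usub => //; apply: Usub => //; exact: Ustab.
  move=> x; have [Gx|/hitx[z _ <-]] := pselect (Gamma x); last by exists z.
  have [y qy] := qs x; have Gy : Gamma y by apply: qG; rewrite /= qy.
  by have [z _ fz] := Gf _ Gy; exists z; rewrite /= fz aG.
apply: nfG => z Gfz; apply: (preG _ niceu); last first.
  by rewrite /= aG //; apply: qGG; exists (f z).
by move=> x /hitx[y nGy qy] /(_ y qy).
Qed.

End LargeFibres.

(** The permutation between p and q sends p x into the fibre of q above h x. *)
Lemma factorization (p q h : Omega -> Omega) :
  U p -> U q -> injective p -> large (~` range p) ->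
  (forall x, ~ Sigma (p x)) -> (forall x, large (fibre q x)) -> U h.
Proof.
move=> Up Uq pinj lp pS lq.
have /choice[e eP] y : exists e : Omega -> Omega,
    [/\ injective e, forall x, (fibre q y `\` Sigma) (e x) &
        large ((fibre q y `\` Sigma) `\` range e)].
  have lqS := large_setDfin Omega_inf (lq y) Sigma_fin.
  by have [e eP] := large_split Omega_inf lqS; exists e.
have qe y x : q (e y x) = y by have [_ /(_ x)[]] := eP y.
have [x0 _] := infinite_setN0 Omega_inf.
have [|||||| a astab aE] := @match_stab Omega Omega_inf Sigma Sigma_fin
    Omega setT p (fun x => e (h x) x).
- by move=> x y _ _ /pinj.
- move=> x y _ _ exy; have hxy : h x = h y by rewrite -(qe (h x) x) exy qe.
  by have [einj _ _] := eP (h x); apply: einj; rewrite exy hxy.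
- by [].
- by move=> x _; have [_ /(_ x)[]] := eP (h x).
- by [].
- have [_ _ le] := eP (h x0); apply: largeS le => y [[qy _] ny] [x _ ex].
  apply: ny; exists x => //; rewrite -ex; congr e.
  by rewrite -qy -ex qe.
suff -> : h = q \o (a \o p).
  by apply: Usub => //; apply: Usub => //; exact: Ustab.
by apply/funext => x /=; rewrite aE // qe.
Qed.

End Sufficiency.

Lemma condition_III_gen (Omega : Type) (Sigma : set Omega)
    (f g : Omega -> Omega) :
  infinite_set [set: Omega] -> finite_set Sigma -> condition_III Sigma f g ->
  generated (pointwise_stab Sigma `|` [set f; g]) = [set: Omega -> Omega].
Proof.
move=> Omega_inf finS [[finj /large_card ld gs gpar] moving].
set U := generated _; have Usub : subsemigroup U by exact: generated_closed.
have gen u : (pointwise_stab Sigma `|` [set f; g]) u -> U u.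
  exact: sub_gen_smallest.
have Uf : U f by apply: gen; right; left.
have Ug : U g by apply: gen; right; right.
have Ustab : pointwise_stab Sigma `<=` U by move=> a astab; apply: gen; left.
have gsurj y : exists x, g x = y by have [x] := gs y I; exists x.
have [||p [Up pinj lp pS]] := @exists_injective_avoiding Omega Omega_inf Sigma
    finS U Usub Ustab f g Uf Ug finj gsurj => //.
  move=> Gamma /moving/[apply] -[[]|[]|[]]; by [left|right|left].
have [||q [Uq lq]] := @exists_all_large_fibres Omega Omega_inf Sigma
    finS U Usub Ustab f g Uf Ug finj gsurj => //.
  move=> Gamma /moving/[apply] -[[]|[]|[]]; by [left|left|right].
apply/seteqP; split=> // h _.
exact: (factorization Omega_inf finS Usub Ustab (p := p) (q := q)).
Qed.

Theorem corollary4p3 (Omega : Type) (Omega_inf : infinite_set [set: Omega])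
    (Sigma : set Omega) (Sigma_ne : Sigma !=set0)
    (Sigma_fin : finite_set Sigma) (f g : Omega -> Omega) :
  [<-> generated (pointwise_stab Sigma `|` [set f; g]) = [set: Omega -> Omega];
       forall Gamma : set Omega, Gamma `<=` Sigma ->
         generated (setwise_stab Gamma `|` [set f; g])
           = [set: Omega -> Omega];
       condition_III Sigma f g \/ condition_III Sigma g f].
Proof.
tfae.
- move=> gen Gamma GS; apply/seteqP; split=> // h _.
  have : [set: Omega -> Omega] h by [].
  rewrite -gen; apply: sub_smallest2r; first exact: generated_closed.
  move=> u [[Symu uS]|fgu]; [left|by right].
  split=> //; rewrite -[RHS]image_id; apply: eq_imagel => x /GS.
  exact: uS.
- exact: setwise_gen_condition_III.
- move=> [|]; first exact: condition_III_gen.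
  by rewrite [[set f; g]]setUC; exact: condition_III_gen.
Qed.
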